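(* Let $\mu$ be a Radon measure on $\mathbb{R}$ with positive Fourier dimension. Then for $\mu$-almost all real numbers $x$, the number $\sum_{n=1}^\infty \frac{[\prod_{j=1}^{n-1}(j!+1) x]}{\prod_{j=1}^n (j!+1)}$ is irrational.
   Context: For a real number $y$, $[y]$ denotes the integer part of $y$; in the numerator, $[\prod_{j=1}^{n-1}(j!+1) x]$ means $[x\prod_{j=1}^{n-1}(j!+1)]$. For a Radon measure $\mu$ on $\mathbb{R}$, its Fourier transform is $\hat{\mu}(t)=\int_{-\infty}^\infty e^{-2\pi i x t}\,d\mu(x)$, and its Fourier dimension is $\dim_F(\mu)=\sup\{\eta\ge 0 : |\hat{\mu}(t)|\ll (1+|t|)^{-\eta/2}\}$. ''Positive Fourier dimension'' means $\dim_F(\mu)>0$. *)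

(* Defs.v *)
From mathcomp Require Import all_boot all_order all_algebra.
From mathcomp Require Import complex.
From mathcomp Require Import all_classical all_reals all_analysis.

Set Implicit Arguments.
Unset Strict Implicit.
Unset Printing Implicit Defensive.

Import Order.TTheory GRing.Theory Num.Theory.
Import numFieldNormedType.Exports.

Local Open Scope classical_set_scope.
Local Open Scope ring_scope.

Section fourier.
Context {R : realType}.
Implicit Types (mu : {measure set (measurableTypeR R) -> \bar R}) (t eta : R).

(* On the real line the first clause implies the second; inner regularity is
   kept because it is part of the usual definition. *)
Definition radon_measure mu : Prop :=
  (forall K : set R, compact K -> (mu K < +oo)%E) /\
  (forall A : set (measurableTypeR R), measurable A ->
    mu A = ereal_sup [set mu K | K in [set K : set R | compact K /\ K `<=` A]]).

(* Integrability of the real and imaginary parts of x |-> e^{-2 pi i x t}. *)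
Definition fourier_integrable mu t : Prop :=
  mu.-integrable setT (fun x : measurableTypeR R => (cos (2 * pi * x * t))%:E) /\
  mu.-integrable setT (fun x : measurableTypeR R => (sin (2 * pi * x * t))%:E).

(* e^{-2 pi i x t} = cos (2 pi x t) - i sin (2 pi x t), integrated
   componentwise since the library only integrates real-valued functions. *)
Definition fourier_transform mu t : R[i] :=
  ((\int[mu]_x cos (2 * pi * x * t)) +i*
   (- \int[mu]_x sin (2 * pi * x * t)))%C.

(* |mu^(t)| << (1 + |t|)^(-eta/2); the estimate presupposes that the integral
   mu^(t) exists, which has to be said because integrals are total here. *)
Definition fourier_decay mu eta : Prop :=
  (forall t, fourier_integrable mu t) /\
  exists C : R, forall t,
    ComplexField.Normc.normc (fourier_transform mu t) <=
      C * (1 + `|t|) `^ (- (eta / 2)).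

Definition fourier_dim mu : \bar R :=
  ereal_sup [set eta%:E | eta in [set eta : R | 0 <= eta /\ fourier_decay mu eta]].

End fourier.

(* Main.v *)
(**
  Put a_j = j! + 1, Q_n = a_1 ... a_(n-1), r_n = sum_(k >= n) 1/a_k and
  c_n = Q_n r_n.  Replacing each floor by its argument minus its fractional part
  shows that Q_n times the n-th tail of the series is c_n x - delta_n with
  0 <= delta_n <= 2/a_n.  If the sum is a/b, then b Q_n times that tail is an
  integer, so b c_n x tends to 0 modulo 1 and cos (2 pi b c_n x) >= 1/2
  eventually.  Since c_(n+1) >= 2 c_n for n >= 4, the sums and differences of
  distinct b c_n are large, and Fourier decay makes these cosines almost
  orthogonal in L^2(mu); this forces the set of such x to be null.
*)
Require Import Defs.
From mathcomp Require Import all_boot all_order all_algebra.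
From mathcomp Require Import all_classical all_reals all_analysis.
From mathcomp Require Import ring lra zify.

Import Order.TTheory GRing.Theory Num.Theory.
Import numFieldNormedType.Exports.

Local Open Scope classical_set_scope.
Local Open Scope ring_scope.

(** * Periodicity of cosine, and series majorised by reciprocals of a doubling sequence *)

Section arithmetic.
Context {R : realType}.
Implicit Types (x y : R) (n m k N M : nat).

Lemma cosD2pi_int y z : z \is a Num.int -> cos (y + 2 * pi * z) = cos y.
Proof.
have pos n v : cos (v + 2 * pi * n%:R) = cos v :> R.
  by rewrite mulrDl mul1r -mulr2n mulr_natr (periodicn (@cosD2pi R)).
case/intrP => -[n|n] ->; first exact: pos.
rewrite NegzE mulrNz mulrN -[in RHS](subrK (2 * pi * n.+1%:R) y).
by rewrite pos.
Qed.

(** Doubling gives 1/w_k <= 2/w_k - 2/w_(k+1), so the sum telescopes; the induction keeps the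
    leftover 2/w_(N+d) on the left. *)
Lemma sum_inv_doubling_le (w : nat -> R) N M :
  (forall k, (N <= k)%N -> 0 < w k /\ 2 * w k <= w k.+1) -> (N <= M)%N ->
  \sum_(N <= k < M) (w k)^-1 <= 2 / w N.
Proof.
move=> wd /subnKC <-; move: (M - N)%N => d {M}.
suff : \sum_(N <= k < N + d) (w k)^-1 + 2 / w (N + d)%N <= 2 / w N.
  apply: le_trans; rewrite lerDl divr_ge0 //.
  by rewrite ltW //; case: (wd (N + d)%N (leq_addr _ _)).
elim: d => [|d IH]; first by rewrite addn0 big_geq // add0r.
rewrite addnS big_nat_recr ?leq_addr //=; apply: le_trans IH.
have [w0 w1] := wd (N + d)%N (leq_addr _ _).
rewrite -addrA lerD2l -lerBrDl.
have -> : 2 / w (N + d)%N - (w (N + d)%N)^-1 = (w (N + d)%N)^-1 by lra.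
rewrite ler_pdivrMr; last by lra.
by rewrite -ler_pdivrMl ?invr_gt0 // invrK mulrC.
Qed.

(** Serves two series: 1/a_k with [w] = a_k, and the fractional parts of Q_k x over Q_(k+1) with w_k
    = Q_(k+1). *)
Lemma partial_sum_doubling_tail (F w : nat -> R) N0 :
  (0 < N0)%N -> (forall k, 0 <= F k) ->
  (forall k, (N0 <= k)%N -> [/\ F k <= (w k)^-1, 0 < w k & 2 * w k <= w k.+1]) ->
  let u n := \sum_(1 <= k < n) F k in
  cvgn u /\ forall N, (N0 <= N)%N -> 0 <= limn u - u N <= 2 / w N.
Proof.
move=> N0_gt0 F0 Fw u.
have ucat N M : (0 < N <= M)%N -> u M = u N + \sum_(N <= k < M) F k.
  by move=> /andP[N1 NM]; rewrite /u (big_cat_nat _ NM).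
have und : {homo u : n m / (n <= m)%N >-> n <= m}.
  move=> [|n] m nm; first by rewrite /u big_geq // sumr_ge0.
  by rewrite (ucat n.+1 m) // lerDl sumr_ge0.
have ub N M : (N0 <= N)%N -> u M <= u N + 2 / w N.
  move=> N0N; have [NM|MN] := leqP N M; last first.
    apply: (le_trans (und _ _ (ltnW MN))); rewrite lerDl divr_ge0 //.
    by rewrite ltW //; case: (Fw _ N0N).
  rewrite (ucat N M) ?NM ?(leq_trans N0_gt0) // lerD2l.
  apply: (@le_trans _ _ (\sum_(N <= k < M) (w k)^-1)).
    rewrite big_nat_cond [leRHS]big_nat_cond; apply: ler_sum => k /andP[/andP[Nk _] _].
    by case: (Fw k (leq_trans N0N Nk)).
  apply: sum_inv_doubling_le => // k Nk.
  by case: (Fw k (leq_trans N0N Nk)).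
have cu : cvgn u.
  apply: nondecreasing_is_cvgn => //; exists (u N0 + 2 / w N0) => _ [n _ <-].
  exact: ub.
split=> // N N0N; rewrite subr_ge0 lerBlDl; apply/andP; split.
  exact: nondecreasing_cvgn_le.
by apply: limr_le => //; apply: nearW => n; exact: ub.
Qed.

(** * The integers a_n, their products Q_n, and the growth of the frequencies c_n *)

Definition factS1 n : R := n`!%:R + 1.

Definition factS1_prod n : R := \prod_(1 <= j < n) factS1 j.

Definition factS1_psum n : R := \sum_(1 <= k < n) (factS1 k)^-1.

(** This is c_n: partial sums stop before [n], so the difference is the tail r_n, which starts with
    1/a_n. *)
Definition factS1_freq n : R :=
  factS1_prod n * (limn factS1_psum - factS1_psum n).

Definition floor_psum x n : R :=
  \sum_(1 <= k < n) ((Num.floor (factS1_prod k * x))%:~R / factS1_prod k.+1).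

Lemma factS1_ge2 n : 2 <= factS1 n.
Proof. by rewrite /factS1 -natr1 lerD2r (ler_nat R 1) fact_gt0. Qed.

Lemma factS1_gt0 n : 0 < factS1 n.
Proof. by apply: lt_le_trans (factS1_ge2 n). Qed.

Lemma factS1_ge n : n%:R <= factS1 n.
Proof.
rewrite /factS1 natr1 ler_nat; case: n => // n.
by rewrite factS (leq_trans (leq_pmulr n.+1 (fact_gt0 n))).
Qed.

Lemma factS1_double n : (2 <= n)%N -> 2 * factS1 n <= factS1 n.+1.
Proof.
move=> n2; rewrite /factS1 !natr1 -natrM ler_nat factS.
by have := fact_gt0 n; nia.
Qed.

(** Rests on 4(n+1) <= n!, true from n = 4 on; this is the source of the threshold 4 below. *)
Lemma factS1_sqr_ge n : (4 <= n)%N -> 4 * factS1 n.+1 <= factS1 n ^+ 2.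
Proof.
move=> n4; have n4f : (4 * n.+1 <= n`!)%N.
  elim: n n4 => // n IH; rewrite leq_eqVlt => /orP[/eqP <- //|n4].
  by rewrite factS; have := IH n4; nia.
rewrite /factS1 !natr1 -natrM -natrX ler_nat factS.
nia.
Qed.

Lemma factS1_prodS n : (0 < n)%N -> factS1_prod n.+1 = factS1_prod n * factS1 n.
Proof. by move=> n0; rewrite /factS1_prod big_nat_recr. Qed.

Lemma factS1_prod_gt0 n : 0 < factS1_prod n.
Proof. by apply: prodr_gt0 => i _; exact: factS1_gt0. Qed.

Lemma factS1_prod_int n : factS1_prod n \is a Num.int.
Proof. by apply: rpred_prod => i _; rewrite /factS1 natr1 natr_int. Qed.

Lemma factS1_psum_tail :
  cvgn factS1_psum /\ forall N, (2 <= N)%N ->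
    0 <= limn factS1_psum - factS1_psum N <= 2 / factS1 N.
Proof.
apply: (@partial_sum_doubling_tail (fun k => (factS1 k)^-1) factS1) => //.
  by move=> k; rewrite invr_ge0 ltW ?factS1_gt0.
by move=> k k2; rewrite lexx factS1_gt0 factS1_double.
Qed.

(** Only the first term 1/a_N of the tail r_N is kept. *)
Lemma factS1_freq_ge N : (2 <= N)%N ->
  factS1_prod N / factS1 N <= factS1_freq N.
Proof.
move=> N2; have [_ tl] := factS1_psum_tail.
have /andP[+ _] := tl N.+1 (leqW N2).
rewrite /factS1_freq ler_pM2l ?factS1_prod_gt0 //.
by rewrite {2}/factS1_psum big_nat_recr ?(ltnW N2) //= -/(factS1_psum N); lra.
Qed.

Lemma factS1_freq_gt0 N : (2 <= N)%N -> 0 < factS1_freq N.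
Proof.
move=> N2; apply: lt_le_trans (factS1_freq_ge N N2).
by rewrite divr_gt0 ?factS1_prod_gt0 ?factS1_gt0.
Qed.

(** The bounds c_N <= 2 Q_N / a_N and c_(N+1) >= Q_N a_N / a_(N+1) reduce the claim to 4 a_(N+1) <=
    a_N^2. *)
Lemma factS1_freq_double N : (4 <= N)%N ->
  2 * factS1_freq N <= factS1_freq N.+1.
Proof.
move=> N4; have N2 : (2 <= N)%N by rewrite (leq_trans _ N4).
apply: le_trans (factS1_freq_ge N.+1 (leqW N2)).
have [_ /(_ N N2) /andP[_ tl]] := factS1_psum_tail.
have Q0 := factS1_prod_gt0 N; have a0 := factS1_gt0 N; have b0 := factS1_gt0 N.+1.
apply: (@le_trans _ _ (2 * (factS1_prod N * (2 / factS1 N)))).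
  by rewrite ler_pM2l // ler_pM2l.
rewrite factS1_prodS ?(ltnW N2) // ler_pdivlMr //.
have -> : 2 * (factS1_prod N * (2 / factS1 N)) * factS1 N.+1 =
  factS1_prod N * (4 * factS1 N.+1 / factS1 N) by ring.
by rewrite ler_pM2l // ler_pdivrMr // -expr2 factS1_sqr_ge.
Qed.

(** Doubling makes c_n unbounded, and c_j - c_i >= c_(i+1) - c_i >= c_i, so a large c_i forces a
    large gap. *)
Lemma factS1_freq_spread T : exists m, forall i j, (m <= i < j)%N ->
  T <= factS1_freq i /\ T <= factS1_freq j - factS1_freq i.
Proof.
have nd i j : (4 <= i)%N -> (i <= j)%N -> factS1_freq i <= factS1_freq j.
  move=> i4 /subnKC <-; elim: (j - i)%N => [|d IH]; first by rewrite addn0.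
  have e4 : (4 <= i + d)%N by rewrite (leq_trans i4) ?leq_addr.
  rewrite addnS; have := factS1_freq_double _ e4.
  by have := factS1_freq_gt0 (i + d) (leq_trans (isT : (2 <= 4)%N) e4); lra.
have lin d : d%:R * factS1_freq 4 <= factS1_freq (4 + d).
  elim: d => [|d IH]; first by rewrite mul0r ltW ?factS1_freq_gt0.
  rewrite addnS -natr1 mulrDl mul1r.
  have := factS1_freq_double _ (leq_addr d 4).
  by have := nd _ _ (leqnn 4) (leq_addr d 4); lra.
have c4 : 0 < factS1_freq 4 by exact: factS1_freq_gt0.
pose d := Num.Def.archi_bound (`|T| / factS1_freq 4).
have Td : T <= factS1_freq (4 + d).
  apply: le_trans (lin d); rewrite -ler_pdivrMr //.
  apply: le_trans (ltW (archi_boundP (divr_ge0 (normr_ge0 T) (ltW c4)))).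
  by rewrite ler_pM2r ?invr_gt0 // ler_norm.
exists (4 + d)%N => i j /andP[di ij].
have i4 : (4 <= i)%N := leq_trans (leq_addr d 4) di.
have Ti := le_trans Td (nd _ _ (leq_addr d 4) di).
split=> //; have := nd _ _ (leqW i4) ij; have := factS1_freq_double _ i4; lra.
Qed.

(** * The floor series, its tails, and the consequence of a rational sum *)

Lemma floor_psum_int x n : factS1_prod n * floor_psum x n \is a Num.int.
Proof.
elim: n => [|[_|n IH]]; [by rewrite /floor_psum big_geq // mulr0|
  by rewrite /floor_psum big_geq // mulr0|].
rewrite /floor_psum big_nat_recr //= -/(floor_psum x n.+1) mulrDr.
rewrite [X in _ + X]mulrCA divff ?gt_eqF ?factS1_prod_gt0 // mulr1.
rewrite factS1_prodS // mulrAC; apply: rpredD; last exact: intr_int.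
by apply: rpredM => //; rewrite /factS1 natr1 natr_int.
Qed.

(* [delta] is [factS1_prod N] times the tail of the sum of the fractional parts
   of [factS1_prod k * x] over [factS1_prod k.+1]. *)
Lemma floor_psum_tail x : cvgn (floor_psum x) /\
  forall N, (2 <= N)%N -> exists2 delta, 0 <= delta <= 2 / factS1 N &
    factS1_prod N * (limn (floor_psum x) - floor_psum x N) =
    factS1_freq N * x - delta.
Proof.
pose F k : R := (factS1_prod k * x - (Num.floor (factS1_prod k * x))%:~R) / factS1_prod k.+1.
have F0 k : 0 <= F k.
  by rewrite divr_ge0 ?(ltW (factS1_prod_gt0 _)) // subr_ge0 floor_le_tmp.
(* A fractional part is below 1, and Q_(k+2) >= 2 Q_(k+1). *)
have [|] := @partial_sum_doubling_tail F (fun k => factS1_prod k.+1) 1 isT F0.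
  move=> k k1; split; last first.
  - by rewrite (factS1_prodS k.+1) // mulrC ler_pM2l ?factS1_prod_gt0 // factS1_ge2.
  - exact: factS1_prod_gt0.
  rewrite ler_pdivrMr ?factS1_prod_gt0 // mulVf ?gt_eqF ?factS1_prod_gt0 //.
  by have := floorD1_gt (factS1_prod k * x); rewrite intrD; lra.
set D := fun n => \sum_(1 <= k < n) F k => cD tD.
have [cs ts] := factS1_psum_tail.
(* Since Q_k x / Q_(k+1) = x / a_k, removing the floors leaves x times the sum of 1/a_k. *)
have SE : floor_psum x = (fun n => factS1_psum n * x - D n).
  apply/funext => n; rewrite /floor_psum /factS1_psum /D mulr_suml -sumrB.
  rewrite !big_nat; apply: eq_bigr => k /andP[k1 _]; rewrite /F factS1_prodS //.
  have := factS1_prod_gt0 k; have := factS1_gt0 k => *.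
  by field; rewrite !gt_eqF.
have cvS : floor_psum x @ \oo --> limn factS1_psum * x - limn D.
  rewrite SE; apply: cvgB => //; apply: cvgM => //; exact: cvg_cst.
split; first by apply/cvg_ex; eexists; exact: cvS.
move=> N N2; have /andP[d0 d1] := tD N (ltnW N2).
exists (factS1_prod N * (limn D - D N)).
  rewrite mulr_ge0 ?(ltW (factS1_prod_gt0 _)) //=.
  apply: (@le_trans _ _ (factS1_prod N * (2 / factS1_prod N.+1))).
    by rewrite ler_pM2l ?factS1_prod_gt0.
  rewrite factS1_prodS ?(ltnW N2) //.
  have := factS1_prod_gt0 N; have := factS1_gt0 N => a0 Q0.
  rewrite le_eqVlt; apply/orP; left; apply/eqP.
  by field; rewrite !gt_eqF.
rewrite (cvg_lim _ cvS) // /factS1_freq SE /=; ring.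
Qed.

Lemma cos_rational_floor_sum x (a : int) (b : nat) : (0 < b)%N ->
  limn (floor_psum x) = a%:~R / b%:R ->
  exists M, forall n, (M <= n)%N ->
    2^-1 <= cos (2 * pi * x * (b%:R * factS1_freq n)).
Proof.
move=> b0 Sab.
have bR : 0 < b%:R :> R by rewrite ltr0n.
have [e e0 cose] : exists2 e : R, 0 < e & forall y, `|y| < e -> 2^-1 <= cos y.
  have : cos y @[y --> (0 : R)] --> (1 : R) by rewrite -cos0; exact: continuous_cos.
  move=> /cvgrPdist_lt /(_ 2^-1); rewrite invr_gt0 ltr0n => /(_ isT).
  move=> /nbhs_ballP[e /= e0 he]; exists e => // y ye.
  have := he y; rewrite /ball /= sub0r normrN => /(_ ye).
  by rewrite ltr_norml => /andP[_]; lra.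
have [_ tl] := floor_psum_tail x.
(* [B] is chosen so that a_n > B gives 2 pi b (2/a_n) < [e]; the [+ 2] in the threshold secures n >=
   2 for the tail estimate. *)
pose B : R := 4 * pi * b%:R / e.
have B0 : 0 <= B.
  by rewrite !mulr_ge0 ?pi_ge0 ?invr_ge0 ?(ltW e0) ?(ltW bR).
exists (Num.Def.archi_bound B + 2)%N => n Mn.
have n2 : (2 <= n)%N := leq_trans (leq_addl _ _) Mn.
have [d /andP[d0 d1] dE] := tl n n2.
(* The integer part of the phase: b c_n x = [k] + b [d] with b [d] small, and cosine ignores [k]. *)
pose k := b%:R * (factS1_prod n * (limn (floor_psum x) - floor_psum x n)).
have kint : k \is a Num.int.
  rewrite /k !mulrBr rpredB //; last by rewrite rpredM ?floor_psum_int // natr_int.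
  rewrite Sab mulrCA [b%:R * _]mulrC -[_ / _ * _]mulrA mulVf ?gt_eqF // mulr1.
  by rewrite rpredM ?factS1_prod_int ?intr_int.
have -> : 2 * pi * x * (b%:R * factS1_freq n) = 2 * pi * (b%:R * d) + 2 * pi * k.
  rewrite /k dE; ring.
rewrite cosD2pi_int //; apply: cose.
have bd0 : 0 <= 2 * pi * (b%:R * d) by rewrite !mulr_ge0 ?pi_ge0 ?(ltW bR).
rewrite ger0_norm //.
apply: (@le_lt_trans _ _ (2 * pi * (b%:R * (2 / factS1 n)))).
  by rewrite ler_pM2l ?mulr_gt0 ?pi_gt0 // ler_pM2l.
have -> : 2 * pi * (b%:R * (2 / factS1 n)) = 4 * pi * b%:R / factS1 n :> R by ring.
rewrite ltr_pdivrMr ?factS1_gt0 // [ltRHS]mulrC -ltr_pdivrMr // -/B.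
apply: (lt_le_trans (archi_boundP B0)).
apply: le_trans (factS1_ge n); rewrite ler_nat.
exact: leq_trans (leq_addr _ _) Mn.
Qed.

End arithmetic.

(** * Fourier decay, near-orthogonality of cosines, and null sets *)

Section fourier_null.
Context {R : realType} (mu : {measure set (measurableTypeR R) -> \bar R}).

(** The real part of the Fourier transform; under [mu_int], [phi 0] is the total mass. *)
Let phi t : R := \int[mu]_x cos (2 * pi * x * t).

Lemma fourier_decay_cos_small (eta : R) : 0 < eta -> fourier_decay mu eta ->
  forall e : R, 0 < e -> exists T : R, forall t : R, T <= `|t| -> phi t <= e.
Proof.
move=> eta0 [_ [C decay]] e e0.
pose a := eta / 2; have a0 : 0 < a by rewrite divr_gt0.
(* [C] may be zero or negative; the positive majorant [C'] lets T solve C' / T^a = e. *)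
pose C' := `|C| + 1; have C'0 : 0 < C' by rewrite ltr_wpDl.
exists ((C' / e) `^ a^-1) => t Tt.
have le_norm : phi t <= C * (1 + `|t|) `^ (- a).
  apply: le_trans (decay t); rewrite /fourier_transform /= -/(phi t).
  apply: (le_trans (ler_norm _)); rewrite -sqrtr_sqr ler_wsqrtr // lerDl.
  exact: sqr_ge0.
have t0 : 0 < 1 + `|t| by rewrite ltr_pwDl.
have pw : C' / e <= (1 + `|t|) `^ a.
  have -> : C' / e = ((C' / e) `^ a^-1) `^ a.
    by rewrite -powRrM mulVf ?gt_eqF // powRr1 // divr_ge0 ?ltW.
  apply: ge0_ler_powR; rewrite ?nnegrE ?powR_ge0 ?ltW //.
  by apply: le_lt_trans Tt _; rewrite ltrDr.
apply: (le_trans le_norm); rewrite powRN.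
apply: (@le_trans _ _ (C' / (1 + `|t|) `^ a)).
  by rewrite ler_pM2r ?invr_gt0 ?powR_gt0 // (le_trans (ler_norm C)) // lerDl.
by rewrite ler_pdivrMr ?powR_gt0 // mulrC -ler_pdivrMr.
Qed.

Hypothesis mu_int : forall t, fourier_integrable mu t.

Let cos_int t : mu.-integrable setT
  (EFin \o (fun x : measurableTypeR R => cos (2 * pi * x * t))).
Proof. by have [] := mu_int t. Qed.

Lemma cos_integral_le t : phi t <= phi 0.
Proof.
apply: le_Rintegral => // x _.
by rewrite mulr0 cos0 cos_le1.
Qed.

Let cosM (s t x : R) : cos (2 * pi * x * s) * cos (2 * pi * x * t) =
  2^-1 * (cos (2 * pi * x * (s - t)) + cos (2 * pi * x * (s + t))).
Proof. by rewrite (mulrBr (2 * pi * x)) (mulrDr (2 * pi * x)) cosB cosD; field. Qed.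

Lemma integrable_cosM s t : mu.-integrable setT
  (EFin \o (fun x : measurableTypeR R =>
     cos (2 * pi * x * s) * cos (2 * pi * x * t))).
Proof.
under [X in _.-integrable _ (_ \o X)]eq_fun do rewrite cosM.
apply: (@integrableZl _ _ _ mu setT measurableT 2^-1
  (EFin \o (fun x => cos (2 * pi * x * (s - t)) + cos (2 * pi * x * (s + t))))).
exact: (integrableD measurableT (cos_int (s - t)) (cos_int (s + t))).
Qed.

Lemma integral_cosM s t :
  \int[mu]_x (cos (2 * pi * x * s) * cos (2 * pi * x * t)) =
  2^-1 * (phi (s - t) + phi (s + t)).
Proof.
under eq_Rintegral do rewrite cosM.
rewrite RintegralZl //; last first.
  exact: (integrableD measurableT (cos_int (s - t)) (cos_int (s + t))).
by rewrite RintegralD.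
Qed.

Lemma Rintegral_sum (I : Type) (s : seq I) (h : I -> measurableTypeR R -> R) :
  (forall i, mu.-integrable setT (EFin \o h i)) ->
  mu.-integrable setT (EFin \o (fun x => \sum_(i <- s) h i x)) /\
  \int[mu]_x (\sum_(i <- s) h i x) = \sum_(i <- s) \int[mu]_x h i x.
Proof.
move=> hint; elim: s => [|i s [IHi IH]].
  under [X in _.-integrable _ (_ \o X)]eq_fun do rewrite big_nil.
  under eq_Rintegral do rewrite big_nil.
  rewrite big_nil Rintegral_cst // mul0r; split => //.
  exact: integrable0.
under [X in _.-integrable _ (_ \o X)]eq_fun do rewrite big_cons.
under eq_Rintegral do rewrite big_cons.
rewrite big_cons -IH; split; last exact: RintegralD.
exact: (integrableD measurableT (hint i) IHi).
Qed.

(* The mean of K well separated cosines is at least 1/2 on E, while the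
   integral of its square is O(1/K) + o(1) by Fourier decay. *)
Lemma spread_cos_null (c : nat -> R) (M : nat) :
  (forall e : R, 0 < e -> exists T : R, forall t : R, T <= `|t| -> phi t <= e) ->
  (forall T, exists m, forall i j, (m <= i < j)%N ->
     T <= c i /\ T <= c j - c i) ->
  mu.-negligible [set x : R |
    forall n, (M <= n)%N -> 2^-1 <= cos (2 * pi * x * c n)].
Proof.
move=> phi_small c_spread; set E := [set x | _].
have mE : measurable (E : set (measurableTypeR R)).
  have -> : E = \bigcap_(n in [set n | (M <= n)%N])
      (fun x : R => cos (2 * pi * x * c n)) @^-1` `[2^-1, +oo[.
    apply/seteqP; split => x xE n nM /=; first by rewrite in_itv/= andbT xE.
    by have := xE n nM; rewrite /= in_itv/= andbT.
  apply: bigcap_measurable => [|n _]; first by exists M; rewrite /=.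
  rewrite -[X in measurable X]setTI.
  apply: measurable_realfun.continuous_measurable_fun => // x.
  apply: continuous_comp; last exact: continuous_cos.
  apply: continuousM; last exact: cst_continuous.
  by apply: continuousM => //; exact: cst_continuous.
exists E; split => //.
have phi0 : 0 <= phi 0 by apply: Rintegral_ge0 => x _; rewrite mulr0 cos0.
have bound (K : nat) (e : R) : 0 < e ->
    (((K.+1%:R / 2) ^+ 2)%:E * mu E <= (K.+1%:R * (phi 0 + K.+1%:R * e))%:E)%E.
  move=> e0.
  (* T >= 0 is arranged so that c_i >= T and c_j - c_i >= T also give c_i + c_j >= T. *)
  have [T T0 small] : exists2 T : R, 0 <= T & forall t : R, T <= `|t| -> phi t <= e.
    have [T hT] := phi_small e e0; exists `|T| => // t Tt.
    by apply: hT; apply: le_trans Tt; exact: ler_norm.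
  have [m hm] := c_spread T.
  (* Indices past [m] are well separated; past [M] the cosines are at least 1/2 on [E]. *)
  pose f i (x : measurableTypeR R) := cos (2 * pi * x * c (maxn m M + i)%N).
  pose g x := \sum_(i < K.+1) \sum_(j < K.+1) f i x * f j x.
  have gE x : g x = (\sum_(i < K.+1) f i x) ^+ 2.
    rewrite expr2 mulr_suml; apply: eq_bigr => i _.
    by rewrite mulr_sumr.
  have fint i : mu.-integrable setT
      (EFin \o (fun x => \sum_(j < K.+1) f i x * f j x)) /\
      \int[mu]_x (\sum_(j < K.+1) f i x * f j x) =
      \sum_(j < K.+1) \int[mu]_x (f i x * f j x).
    apply: (@Rintegral_sum _ _ (fun j x => f i x * f (nat_of_ord j) x)) => j.
    exact: integrable_cosM.
  have [gint gI] := @Rintegral_sum _ (index_enum 'I_K.+1)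
    (fun i x => \sum_(j < K.+1) f i x * f j x) (fun i => (fint i).1).
  have far i j : (i < j)%N -> \int[mu]_x (f i x * f j x) <= e /\
      \int[mu]_x (f j x * f i x) <= e.
    move=> ij; rewrite !integral_cosM.
    have [|Ti Tij] := hm (maxn m M + i)%N (maxn m M + j)%N.
      by rewrite ltn_add2l ij andbT (leq_trans (leq_maxl m M)) // leq_addr.
    have := small (c (maxn m M + i)%N - c (maxn m M + j)%N).
    rewrite distrC => /(_ (le_trans Tij (ler_norm _))).
    have := small (c (maxn m M + j)%N - c (maxn m M + i)%N) (le_trans Tij (ler_norm _)).
    have : T <= `|c (maxn m M + i)%N + c (maxn m M + j)%N|.
      by apply: (le_trans _ (ler_norm _)); lra.
    move=> /small; rewrite [c (maxn m M + j)%N + c _]addrC => p1 p2 p3.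
    by split; lra.
  have diag i : \int[mu]_x (f i x * f i x) <= phi 0.
    rewrite integral_cosM subrr.
    by have := cos_integral_le (c (maxn m M + i)%N + c (maxn m M + i)%N); lra.
  have gle : \int[mu]_x g x <= K.+1%:R * (phi 0 + K.+1%:R * e).
    rewrite gI.
    have row (i : 'I_K.+1) :
        \int[mu]_x (\sum_(j < K.+1) f i x * f j x) <= phi 0 + K.+1%:R * e.
      rewrite (fint i).2 (bigD1 i) //= lerD //.
      apply: (@le_trans _ _ (\sum_(j < K.+1) e)); last first.
        by rewrite sumr_const card_ord mulr_natl.
      rewrite [leRHS](bigD1 i) //= ler_wpDl ?(ltW e0) //.
      apply: ler_sum => j ji; have [ij|ij|/val_inj ij] := ltngtP i j.
      - exact: (far _ _ ij).1.
      - exact: (far _ _ ij).2.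
      - by rewrite ij eqxx in ji.
    apply: (le_trans (ler_sum _ (fun i _ => row i))).
    by rewrite sumr_const card_ord -[leLHS]mulr_natl.
  have /integrableP[gm _] := gint.
  have g0 x : (0 <= (g x)%:E)%E by rewrite lee_fin gE sqr_ge0.
  (* Chebyshev: on [E] the K+1 cosines sum to at least (K+1)/2, so [g] is at least its square
     there. *)
  apply: (@le_trans _ _ (\int[mu]_(x in E) (g x)%:E)%E).
    rewrite -integral_cst //; apply: ge0_le_integral => //.
    - by move=> x _; rewrite lee_fin sqr_ge0.
    - exact: (measurable_funS measurableT (@subsetT _ E) gm).
    move=> x xE; rewrite lee_fin gE ler_sqr ?nnegrE; last 2 first.
    - by rewrite divr_ge0.
    - apply: sumr_ge0 => i _; apply: (@le_trans _ _ 2^-1) => //.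
      by apply: xE; rewrite (leq_trans (leq_maxr m M)) ?leq_addr.
    have -> : K.+1%:R / 2 = \sum_(i < K.+1) 2^-1 :> R.
      by rewrite sumr_const card_ord mulr_natl.
    apply: ler_sum => i _; apply: xE.
    by rewrite (leq_trans (leq_maxr m M)) ?leq_addr.
  apply: (@le_trans _ _ (\int[mu]_x (g x)%:E)%E).
    by apply: ge0_subset_integral.
  have <- : (\int[mu]_x g x)%:E = (\int[mu]_x (g x)%:E)%E.
    by rewrite fineK //; exact: integrable_fin_num.
  by rewrite lee_fin.
apply/eqP; rewrite eq_le measure_ge0 andbT.
apply/lee_addgt0Pr => d d0; rewrite add0e.
(* With e = d/8, [bound] reads mu E <= 4 phi(0)/(K+1) + d/2, and this K makes the first term at most
   d/2. *)
pose K := Num.Def.archi_bound (8 * phi 0 / d).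
have Kd : 8 * phi 0 / d < K%:R.
  by apply: archi_boundP; rewrite divr_ge0 ?mulr_ge0 ?(ltW d0).
have := bound K (d / 8); rewrite divr_gt0 // => /(_ isT).
have k0 : 0 < K.+1%:R :> R by rewrite ltr0n.
have Kd' : 8 * phi 0 <= K.+1%:R * d.
  by rewrite -ler_pdivrMr // (le_trans (ltW Kd)) // ler_nat.
rewrite -lee_pdivlMl; last by rewrite exprn_gt0 // divr_gt0.
move=> /le_trans; apply; rewrite -EFinM lee_fin.
rewrite ler_pdivrMl ?exprn_gt0 ?divr_gt0 //.
by nra.
Qed.

End fourier_null.

(** * Countable union over denominators and thresholds *)

Theorem theorem5 (R : realType)
    (mu : {measure set (measurableTypeR R) -> \bar R})
    (mu_radon : radon_measure mu) (mu_dim : (0 < fourier_dim mu)%E) :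
  {ae mu, forall x : R,
    irrational (\big[+%R/0]_(1 <= n <oo)
      ((Num.floor ((\prod_(1 <= j < n) (j`!%:R + 1)) * x))%:~R /
        \prod_(1 <= j < n.+1) (j`!%:R + 1) : R))}.
Proof.
have [_ [eta [_ decay] <-]] := ereal_sup_gt mu_dim; rewrite lte_fin => eta0.
pose E b M := [set x : R | forall n, (M <= n)%N ->
  2^-1 <= cos (2 * pi * x * (b.+1%:R * factS1_freq n))].
have nullE b M : mu.-negligible (E b M).
  apply: (@spread_cos_null _ mu decay.1 (fun n => b.+1%:R * factS1_freq n)).
    exact: fourier_decay_cos_small eta0 decay.
  (* Multiplying by b+1 >= 1 preserves lower bounds that are nonnegative, hence the passage to the
     absolute value of T. *)
  move=> T; have [m hm] := @factS1_freq_spread R `|T|; exists m => i j /hm[Ti Tij].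
  have b1 : 1 <= b.+1%:R :> R by rewrite ler1n.
  have mono y : `|T| <= y -> T <= b.+1%:R * y.
    move=> Ty; apply: (le_trans (ler_norm T)); apply: (le_trans Ty).
    by rewrite ler_peMl // (le_trans (normr_ge0 T)).
  by rewrite -mulrBr; split; exact: mono.
have : mu.-negligible (\bigcup_b \bigcup_M E b M).
  by apply: negligible_bigcup => b; exact: negligible_bigcup.
apply: negligibleS.
move=> x /= /contrapT /rationalP[a [b Sab]].
have {}Sab : limn (floor_psum x) = a%:~R / b%:R by exact: Sab.
have {a b Sab} [a [b Sab]] : exists (a : int) (b : nat),
    limn (floor_psum x) = a%:~R / b.+1%:R.
  (* A zero denominator gives the value 0 by convention, rewritten here as 0/1. *)
  case: b Sab => [|b] Sab; last by exists a, b.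
  by exists 0, 0%N; rewrite Sab invr0 mulr0 mul0r.
have [M hM] := @cos_rational_floor_sum R x a b.+1 isT Sab.
by exists b => //; exists M.
Qed.
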